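(* The functor $k:\mathsf{Stfd}\to\mathsf{Diffeology}$, $k(S,\mathcal{C})=(S,\mathcal{D}_{\mathcal{C}})$, $k(\phi)=\phi$, induces an equivalence of categories $k:\mathsf{Stfd}\to\langle\mathsf{Im}\,k\rangle_W$, where $\langle\mathsf{Im}\,k\rangle$ is the full subcategory of $\mathsf{Diffeology}$ consisting of the objects which come from $\mathsf{Stfd}$ by $k$, and $\langle\mathsf{Im}\,k\rangle_W$ is the wide subcategory of $\langle\mathsf{Im}\,k\rangle$ consisting of the admissible maps and the same class of objects as in $\langle\mathsf{Im}\,k\rangle$. In particular, one has a natural bijection $$k_*:\mathrm{Hom}_{\mathsf{Stfd}}((S,\mathcal{C}),(S',\mathcal{C}'))\stackrel{\cong}{\to}\mathrm{Hom}_{\langle\mathsf{Im}\,k\rangle_W}((S,\mathcal{D}_{\mathcal{C}}),(S',\mathcal{D}_{\mathcal{C}'})).$$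
   Context: A differential space is a pair $(S,\mathcal{C})$ of a topological space $S$ and an $\mathbb{R}$-subalgebra $\mathcal{C}$ of the algebra $C^0(S)$ of continuous real-valued functions on $S$ which is locally detectable ($f\in\mathcal{C}$ if and only if for every $x\in S$ there are an open neighborhood $U$ of $x$ and $g\in\mathcal{C}$ with $f|_U=g|_U$) and $C^\infty$-closed (for all $n\ge 1$, $f_1,\dots,f_n\in\mathcal{C}$ and smooth $g:\mathbb{R}^n\to\mathbb{R}$, the function $x\mapsto g(f_1(x),\dots,f_n(x))$ is in $\mathcal{C}$). A morphism of differential spaces $f:(S,\mathcal{C})\to(S',\mathcal{C}')$ is a continuous map $f:S\to S'$ with $\varphi\circ f\in\mathcal{C}$ for all $\varphi\in\mathcal{C}'$. For a subspace $Y\subset S$, $\mathcal{C}_Y\subset C^0(Y)$ is the algebra of locally extendable functions: those $g$ such that each $x\in Y$ has an open neighborhood $V$ in $Y$ and $h\in\mathcal{C}$ with $g|_V=h|_V$; $(Y,\mathcal{C}_Y)$ is a differential space. For $x\in S$, $\mathcal{C}_x$ is the algebra of germs at $x$ of elements of $\mathcal{C}$ and $T_xS$ is the vector space of derivations of $\mathcal{C}_x$ (at $x$, i.e. into $\mathbb{R}$ via evaluation at $x$). A stratifold is a differential space $(S,\mathcal{C})$ such that: (1) $S$ is locally compact Hausdorff with countable basis; (2) the skeleta $sk_k(S)=\{x\in S\mid \dim T_xS\le k\}$ are closed in $S$; (3) for each $x\in S$ and open neighborhood $U$ of $x$ there is a non-negative $\rho\in\mathcal{C}$ with $\rho(x)\ne0$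 and $\mathrm{supp}\,\rho\subset U$; (4) the strata $S^k:=sk_k(S)-sk_{k-1}(S)$ are $k$-dimensional smooth manifolds such that restriction along $S^k\hookrightarrow S$ induces an isomorphism $\mathcal{C}_x\to C^\infty(S^k)_x$ for each $x\in S^k$. All stratifolds are assumed finite-dimensional: $S=sk_n(S)$ for some $n\ge 0$. $\mathsf{Stfd}$ is the full subcategory of the category of differential spaces spanned by the stratifolds. A local retraction near $x\in S^i$ is a morphism of differential spaces $r_x:(U,\mathcal{C}_U)\to(U\cap S^i,\mathcal{C}_{U\cap S^i})$, $U$ an open neighborhood of $x$ in $S$, with $r_x|_{U\cap S^i}=\mathrm{id}$. $\mathsf{Diffeology}$ is the category of diffeological spaces; its morphisms are the set maps that send plots to plots under composition. For a stratifold $(S,\mathcal{C})$, $\mathcal{D}_{\mathcal{C}}$ is the diffeology whose plots are the set maps $u:U\to S$, $U$ open in $\mathbb{R}^q$, $q\ge0$, with $\phi\circ u\in C^\infty(U)$ for all $\phi\in\mathcal{C}$. For stratifolds $(S,\mathcal{C})$, $(S',\mathcal{C}')$, a continuous map $f:S\to S'$ is $(\mathcal{C},\mathcal{C}')$-admissible if for any $x\in S$ there exist local retractions $r_x$ near $x$ and $r_{f(x)}$ near $f(x)$ such that $r_{f(x)}\circ f\circ r_x=r_{f(x)}\circ f$ on some neighborhood of $x$, and for each $\phi\in\mathcal{C}'$ the restriction of $\phi\circ f:S\to\mathbb{R}$ to any stratum $S^i$ of $(S,\mathcal{C})$ is smooth. For stratifolds $(S,\mathcal{C})$, $(S',\mathcal{C}')$,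 $(S'',\mathcal{C}'')$, the composite of a $(\mathcal{C},\mathcal{C}')$-admissible map and a $(\mathcal{C}',\mathcal{C}'')$-admissible map is $(\mathcal{C},\mathcal{C}'')$-admissible.
   Formalization: An object of ⟨Im k⟩ is a diffeological space together with a chosen stratifold (S,C) that k sends to it, since D_C does not determine C and admissibility depends on C; morphisms are still all diffeological maps between the underlying spaces. *)

(* Defs.v *)
From HB Require Import structures.
From mathcomp Require Import all_boot all_order all_algebra.
From mathcomp Require Import all_classical all_reals all_analysis.
Set Implicit Arguments.
Unset Strict Implicit.
Unset Printing Implicit Defensive.
Import Order.TTheory GRing.Theory Num.Theory.
Import numFieldNormedType.Exports.
Local Open Scope classical_set_scope.
Local Open Scope ring_scope.

Section Smooth.
Context {R : realType}.

(* For U open: all iterated directional derivatives of f up to order n exist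
   and are continuous on U, those of order < n being Frechet differentiable. *)
Fixpoint Ck_on (V W : normedModType R) (U : set V) (n : nat) (f : V -> W) :
    Prop :=
  if n is m.+1 then
    (forall x, U x -> differentiable f x) /\
    (forall v, Ck_on U m (fun x => 'D_v f x))
  else forall x, U x -> {for x, continuous f}.

Definition smooth_on (V W : normedModType R) (U : set V) (f : V -> W) :=
  forall n, Ck_on U n f.

(* For U open this does not depend on the extension g, since the conditions in
   smooth_on are local. *)
Definition smooth_map (V W : normedModType R) (U : set V) (f : U -> W) :=
  exists2 g : V -> W, smooth_on U g & forall x : U, f x = g (set_val x).

Lemma near_eq_differentiable (V W : normedModType R) (f g : V -> W) (x : V) :
  (\forall y \near x, f y = g y) -> differentiable f x -> differentiable g x.
Proof.
move=> fg df.
have [dfc /eqaddoP dfE] := (diff_locallyP x f).1 df.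
have fgx : f x = g x by exact: (nbhs_singleton fg).
have gE : g \o shift x = cst (g x) + 'd f x +o_ 0 id.
  apply/eqaddoP => e e0.
  have nfg : \forall h \near (0 : V), f (h + x) = g (h + x).
    by move: fg; rewrite (near_shift 0 x); apply: filterS => h /=; rewrite subr0.
  apply: filterS2 (dfE e e0) nfg => h /=.
  by rewrite !fctE /= -fgx => + <-.
by apply/diff_locallyP; rewrite (diff_unique dfc gE).
Qed.

Section Ck.
Variable V : normedModType R.
Implicit Types (W : normedModType R) (U : set V).

Lemma Ck_on_ext W U n (f g : V -> W) : open U ->
  (forall x, U x -> f x = g x) -> Ck_on U n f -> Ck_on U n g.
Proof.
move=> oU; elim: n f g => [|n IH] f g fg /=.
  move=> cf x Ux; have nfg : \forall y \near x, f y = g y.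
    by apply: filterS (open_nbhs_nbhs (conj oU Ux)) => y /fg.
  have := cf x Ux; rewrite /prop_for /continuous_at fg // => h.
  exact: cvg_trans (near_eq_cvg nfg) h.
move=> [df Df]; have nfg x : U x -> \forall y \near x, f y = g y.
  by move=> Ux; apply: filterS (open_nbhs_nbhs (conj oU Ux)) => y /fg.
split=> [x Ux|v]; first exact: near_eq_differentiable (nfg x Ux) (df x Ux).
apply: IH (Df v) => x Ux; exact: near_eq_derive (nfg x Ux).
Qed.

Lemma Ck_on_local W U n (f : V -> W) :
  (forall x, U x -> exists2 U' : set V, U' x & Ck_on U' n f) -> Ck_on U n f.
Proof.
elim: n f => [|n IH] f h /=; first by move=> x /h[U' U'x /(_ x U'x)].
split=> [x /h[U' U'x [/(_ x U'x)]]|v] //.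
by apply: IH => x /h[U' U'x [_ Df]]; exists U' => //; exact: Df.
Qed.

Lemma Ck_onW W U n (f : V -> W) : Ck_on U n.+1 f -> Ck_on U n f.
Proof.
elim: n f => [|n IH] f [df Df]; first by move=> x /df/differentiable_continuous.
by split=> // v; apply: IH; exact: Df.
Qed.

Lemma Ck_on_cst W U n (a : W) : Ck_on U n (fun _ => a).
Proof.
elim: n a => [|n IH] a /=; first by move=> x _; exact: cst_continuous.
split=> [x _|v]; first exact: (differentiable_cst a x).
have -> : (fun x => 'D_v (fun=> a) x) = (fun=> 0 : W); last exact: IH.
by apply/funext => x; exact: derive_cst.
Qed.

Lemma Ck_onD W U n (f g : V -> W) : open U ->
  Ck_on U n f -> Ck_on U n g -> Ck_on U n (fun x => f x + g x).
Proof.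
move=> oU; elim: n f g => [|n IH] f g /=.
  by move=> cf cg x Ux; apply: (@continuousD _ _ _ f g); [exact: cf|exact: cg].
move=> [df Df] [dg Dg]; split=> [x Ux|v].
  by apply: (@differentiableD _ _ _ f g); [exact: df|exact: dg].
apply: Ck_on_ext (IH _ _ (Df v) (Dg v)) => // x Ux.
by rewrite -deriveD //; apply: diff_derivable; do [exact: df|exact: dg].
Qed.

Lemma Ck_onM U n (f g : V -> R) : open U ->
  Ck_on U n f -> Ck_on U n g -> Ck_on U n (fun x => f x * g x).
Proof.
move=> oU; elim: n f g => [|n IH] f g.
  by move=> cf cg x Ux; apply: (@continuousM _ _ f g); [exact: cf|exact: cg].
move=> Cf Cg; have [[df Df] [dg Dg]] := (Cf, Cg); split=> [x Ux|v].
  by apply: (@differentiableM _ _ f g); [exact: df|exact: dg].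
apply: (@Ck_on_ext _ _ _ (fun x => f x * 'D_v g x + g x * 'D_v f x)) => //.
  move=> x Ux; rewrite (@deriveM _ _ f g) //.
    by apply: diff_derivable; exact: df.
  by apply: diff_derivable; exact: dg.
by apply: Ck_onD => //; apply: IH => //; do [exact: Ck_onW|exact: Df|exact: Dg].
Qed.

Lemma Ck_on_sum U n (I : Type) (s : seq I) (F : I -> V -> R) : open U ->
  (forall i, Ck_on U n (F i)) -> Ck_on U n (fun x => \sum_(i <- s) F i x).
Proof.
move=> oU h; elim: s => [|i s IH].
  by under [X in Ck_on _ _ X]eq_fun do rewrite big_nil; exact: Ck_on_cst.
by under [X in Ck_on _ _ X]eq_fun do rewrite big_cons; exact: Ck_onD.
Qed.

Lemma derive_coord q (h : V -> 'rV[R]_q) (j : 'I_q) (v x : V) :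
  differentiable h x -> 'D_v (fun y => h y 0 j) x = ('D_v h x) 0 j.
Proof.
move=> dh; rewrite derive_mx ?mxE //; exact: diff_derivable.
Qed.

Lemma Ck_on_coord q U n (h : V -> 'rV[R]_q) (j : 'I_q) : open U ->
  Ck_on U n h -> Ck_on U n (fun x => h x 0 j).
Proof.
move=> oU; elim: n h => [|n IH] h /=.
  move=> ch x Ux; apply: (@continuous_comp _ _ _ h (fun M => M 0 j)).
    exact: ch.
  exact: coord_continuous.
move=> [dh Dh]; split=> [x Ux|v].
  apply: (@differentiable_comp _ _ _ _ h (fun M => M 0 j)); first exact: dh.
  exact: differentiable_coord.
apply: Ck_on_ext (IH _ (Dh v)) => // x Ux; rewrite derive_coord //; exact: dh.
Qed.

Lemma Ck_on_comp q (U : set V) (U' : set 'rV[R]_q) n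
    (h : V -> 'rV[R]_q) (f : 'rV[R]_q -> R) : open U -> open U' ->
  (forall x, U x -> U' (h x)) ->
  Ck_on U n h -> Ck_on U' n f -> Ck_on U n (f \o h).
Proof.
move=> oU oU' hU; elim: n f => [|n IH] f.
  move=> ch cf x Ux; apply: continuous_comp; first exact: ch.
  exact/cf/hU.
move=> Ch Cf; have [[dh Dh] [df Df]] := (Ch, Cf).
split=> [x Ux|v].
  by apply: differentiable_comp; [exact: dh|exact/df/hU].
apply: (@Ck_on_ext _ _ _
  (fun x => \sum_(j < q) 'D_v h x 0 j * 'D_(delta_mx 0 j) f (h x))) => //.
  move=> x Ux; have dhx := dh x Ux; have dfx := df _ (hU x Ux).
  rewrite [RHS](deriveE v (differentiable_comp dhx dfx)) diff_comp //=.
  rewrite -(deriveE v dhx) [X in 'd f _ X](row_sum_delta ('D_v h x)).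
  rewrite linear_sum /=; apply: eq_bigr => j _.
  by rewrite linearZ /= (deriveE _ dfx).
apply: Ck_on_sum => // j; apply: Ck_onM => //.
  exact: Ck_on_coord (Dh v).
apply: (IH (fun y => 'D_(delta_mx 0 j) f y)); last exact: Df.
exact: (Ck_onW Ch).
Qed.

End Ck.

End Smooth.

Definition subset_incl (T : Type) (A B : set T) (AB : A `<=` B) (x : A) : B :=
  exist _ (set_val x) (mem_set (AB _ (set_mem (svalP x)))).

Record diffspace (R : realType) := Diffspace {
  ds_top :> topologicalType;
  ds_fun : set (ds_top -> R);
  ds_cont : forall f, ds_fun f -> continuous f;
  ds_cst : forall a : R, ds_fun (cst a);
  ds_add : forall f g, ds_fun f -> ds_fun g -> ds_fun (f \+ g);
  ds_mul : forall f g, ds_fun f -> ds_fun g -> ds_fun (f \* g);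
  ds_local : forall f, ds_fun f <-> forall x, exists U : set ds_top,
    [/\ open U, U x & exists2 g, ds_fun g & forall y, U y -> f y = g y];
  ds_smooth : forall n (fs : 'I_n -> ds_top -> R) (g : 'rV[R]_n -> R),
    (0 < n)%N -> (forall i, ds_fun (fs i)) -> smooth_on setT g ->
    ds_fun (fun x => g (\row_i fs i x)) }.

Section SubDiffspace.
Context {R : realType} (S : diffspace R) (Y : set S).

Definition sub_fun : set (Y -> R) := [set g | forall x : Y,
  exists V : set Y, [/\ open V, V x &
    exists2 h, ds_fun h & forall y, V y -> g y = h (set_val y)]].

Lemma sub_cont g : sub_fun g -> continuous g.
Proof.
move=> sg x; have [V [oV Vx [h Ch gh]]] := sg x.
have nhg : \forall y \near x, h (set_val y) = g y.
  by apply: filterS (open_nbhs_nbhs (conj oV Vx)) => y /gh.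
rewrite /continuous_at gh //.
apply: cvg_trans (near_eq_cvg nhg) _.
apply: (@continuous_comp _ _ _ (@set_val _ Y) h); last exact: ds_cont.
exact: initial_continuous.
Qed.

Lemma sub_cst a : sub_fun (cst a).
Proof.
move=> x; exists setT; split=> //; first exact: openT.
by exists (cst a); first exact: ds_cst.
Qed.

Lemma sub_op (op : (S -> R) -> (S -> R) -> S -> R) (op' : R -> R -> R) f g :
  (forall f g, ds_fun f -> ds_fun g -> ds_fun (op f g)) ->
  (forall f g x, op f g x = op' (f x) (g x)) ->
  sub_fun f -> sub_fun g -> sub_fun (fun x => op' (f x) (g x)).
Proof.
move=> Cop opE sf sg x.
have [V [oV Vx [h Ch fh]]] := sf x; have [V' [oV' V'x [h' Ch' gh']]] := sg x.
exists (V `&` V'); split; [exact: openI|by []|exists (op h h')].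
  exact: Cop.
by move=> y [Vy V'y]; rewrite opE fh // gh'.
Qed.

Lemma sub_local f : sub_fun f <-> forall x, exists U : set Y,
  [/\ open U, U x & exists2 g, sub_fun g & forall y, U y -> f y = g y].
Proof.
split=> [sf x|lf x].
  by exists setT; split=> //; [exact: openT|exists f].
have [U [oU Ux [g sg fg]]] := lf x; have [V [oV Vx [h Ch gh]]] := sg x.
exists (U `&` V); split; [exact: openI|by []|exists h => //].
by move=> y [Uy Vy]; rewrite fg // gh.
Qed.

Lemma sub_smooth n (fs : 'I_n -> Y -> R) (g : 'rV[R]_n -> R) :
  (0 < n)%N -> (forall i, sub_fun (fs i)) -> smooth_on setT g ->
  sub_fun (fun x => g (\row_i fs i x)).
Proof.
move=> n0 sfs sg x.
have /choice[Vh Vhp] : forall i, exists Vh : set Y * (S -> R),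
    [/\ open Vh.1, Vh.1 x, ds_fun Vh.2 &
        forall y, Vh.1 y -> fs i y = Vh.2 (set_val y)].
  by move=> i; have [V [oV Vx [h Ch gh]]] := sfs i x; exists (V, h).
have nV : \forall y \near x, forall i, (Vh i).1 y.
  apply: (@filter_forall _ _ (fun i => (Vh i).1) (nbhs x)) => i; have [oV Vx _ _] := Vhp i.
  exact: (open_nbhs_nbhs (conj oV Vx)).
have : nbhs x [set y | forall i, (Vh i).1 y] := nV.
rewrite nbhsE => -[V [oV Vx] VV].
exists V; split=> //; exists (fun s => g (\row_i (Vh i).2 s)).
  by apply: ds_smooth => // i; have [] := Vhp i.
move=> y Vy; congr g; apply/rowP => i; rewrite !mxE.
by have [_ _ _] := Vhp i; apply; exact: VV.
Qed.

Definition subds : diffspace R := @Diffspace R Y sub_fun sub_cont sub_cst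
  (fun f g => @sub_op _ _ f g (@ds_add R S) (fun _ _ _ => erefl))
  (fun f g => @sub_op _ _ f g (@ds_mul R S) (fun _ _ _ => erefl))
  sub_local sub_smooth.

End SubDiffspace.

Definition ds_morphism (R : realType) (S T : diffspace R) (f : S -> T) :=
  continuous f /\ forall phi, ds_fun phi -> ds_fun (phi \o f).

Record category := Category {
  cobj :> Type;
  chom : cobj -> cobj -> Type;
  cidm : forall X, chom X X;
  ccomp : forall X Y Z, chom Y Z -> chom X Y -> chom X Z;
  cidl : forall X Y (f : chom X Y), ccomp (cidm Y) f = f;
  cidr : forall X Y (f : chom X Y), ccomp f (cidm X) = f;
  ccompA : forall X Y Z T (f : chom Z T) (g : chom Y Z) (h : chom X Y),
    ccomp f (ccomp g h) = ccomp (ccomp f g) h }.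
Arguments chom {c}.
Arguments cidm {c}.
Arguments ccomp {c X Y Z}.

Record functor (C D : category) := Functor {
  fobj :> C -> D;
  fmor : forall X Y, chom X Y -> chom (fobj X) (fobj Y);
  fmor_id : forall X, fmor (cidm X) = cidm (fobj X);
  fmor_comp : forall X Y Z (f : chom Y Z) (g : chom X Y),
    fmor (ccomp f g) = ccomp (fmor f) (fmor g) }.
Arguments fmor {C D} _ {X Y} _.

Definition functor_id (C : category) : functor C C :=
  @Functor C C id (fun _ _ f => f) (fun _ => erefl) (fun _ _ _ _ _ => erefl).

Section FunctorComp.
Variables (C D E : category) (G : functor D E) (F : functor C D).
Lemma functor_comp_id X : fmor G (fmor F (cidm X)) = cidm (G (F X)).
Proof. by rewrite !fmor_id. Qed.
Lemma functor_comp_comp X Y Z (f : chom Y Z) (g : chom X Y) :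
  fmor G (fmor F (ccomp f g)) = ccomp (fmor G (fmor F f)) (fmor G (fmor F g)).
Proof. by rewrite !fmor_comp. Qed.
Definition functor_comp : functor C E :=
  @Functor C E (fun X => G (F X)) (fun X Y f => fmor G (fmor F f))
    functor_comp_id functor_comp_comp.
End FunctorComp.

Definition is_iso (C : category) (X Y : C) (f : chom X Y) :=
  exists2 g : chom Y X, ccomp g f = cidm X & ccomp f g = cidm Y.

Definition nat_iso (C D : category) (F G : functor C D) :=
  exists eta : forall X, chom (F X) (G X),
    (forall X Y (f : chom X Y),
       ccomp (eta Y) (fmor F f) = ccomp (fmor G f) (eta X)) /\
    (forall X, is_iso (eta X)).

Definition is_equivalence (C D : category) (F : functor C D) :=
  exists G : functor D C,
    nat_iso (functor_comp G F) (functor_id C) /\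
    nat_iso (functor_comp F G) (functor_id D).

Lemma sig_val_inj (T : Type) (P : T -> Prop) (x y : {x | P x}) :
  sval x = sval y -> x = y.
Proof. by case: x y => x Px [y Py] /= xy; exact: eq_exist. Qed.

Definition full_subcat (C : category) (P : C -> Prop) : category :=
  @Category {X : C | P X} (fun X Y => chom (sval X) (sval Y))
    (fun X => cidm (sval X)) (fun X Y Z => @ccomp C _ _ _)
    (fun _ _ => @cidl C _ _) (fun _ _ => @cidr C _ _)
    (fun _ _ _ _ => @ccompA C _ _ _ _).

Definition is_wide (C : category) (P : forall X Y : C, chom X Y -> Prop) :=
  (forall X, P _ _ (cidm X)) /\
  (forall X Y Z (f : chom Y Z) (g : chom X Y),
     P _ _ f -> P _ _ g -> P _ _ (ccomp f g)).

Section WideSubcategory.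
Variables (C : category) (P : forall X Y : C, chom X Y -> Prop).
Hypothesis w : is_wide P.
Definition wide_hom X Y := {f : chom X Y | P f}.
Definition wide_idm X : wide_hom X X := exist _ (cidm X) (w.1 X).
Definition wide_comp X Y Z (f : wide_hom Y Z) (g : wide_hom X Y) :
    wide_hom X Z :=
  exist _ (ccomp (sval f) (sval g)) (w.2 _ _ _ _ _ (svalP f) (svalP g)).
Lemma wide_idl X Y (f : wide_hom X Y) : wide_comp (wide_idm Y) f = f.
Proof. exact/sig_val_inj/cidl. Qed.
Lemma wide_idr X Y (f : wide_hom X Y) : wide_comp f (wide_idm X) = f.
Proof. exact/sig_val_inj/cidr. Qed.
Lemma wide_compA X Y Z T (f : wide_hom Z T) (g : wide_hom Y Z)
    (h : wide_hom X Y) :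
  wide_comp f (wide_comp g h) = wide_comp (wide_comp f g) h.
Proof. exact/sig_val_inj/ccompA. Qed.
Definition wide_subcat : category := Category wide_idl wide_idr wide_compA.
End WideSubcategory.

(* An object of the full image comes with a chosen preimage under F: two
   stratifolds may have the same underlying diffeological space without being
   isomorphic, and admissibility of a map depends on the stratifolds. *)
Record full_image_obj (C D : category) (F : functor C D) := FullImageObj {
  im_obj : D;
  im_src : C;
  im_eq : F im_src = im_obj }.

Definition full_image (C D : category) (F : functor C D) : category :=
  @Category (full_image_obj F) (fun X Y => chom (im_obj X) (im_obj Y))
    (fun X => cidm (im_obj X)) (fun X Y Z => @ccomp D _ _ _)
    (fun _ _ => @cidl D _ _) (fun _ _ => @cidr D _ _)
    (fun _ _ _ _ => @ccompA D _ _ _ _).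

Definition hom_transport (C : category) (X X' Y Y' : C)
    (eX : X = X') (eY : Y = Y') : chom X' Y' -> chom X Y :=
  match eX, eY with erefl, erefl => id end.

Section Corestriction.
Variables (C D : category) (F : functor C D).
Definition full_image_of (X : C) : full_image F := FullImageObj (erefl (F X)).
Variable P : forall X Y : full_image F, chom X Y -> Prop.
Hypothesis w : is_wide P.
Hypothesis FP : forall (X Y : C) (f : chom X Y),
  @P (full_image_of X) (full_image_of Y) (fmor F f).
Definition corestrict_map X Y (f : chom X Y) :
    @chom (wide_subcat w) (full_image_of X) (full_image_of Y) :=
  exist _ (fmor F f) (FP f).
Lemma corestrict_id X :
  corestrict_map (cidm X) = cidm (full_image_of X : wide_subcat w).
Proof. exact/sig_val_inj/fmor_id. Qed.
Lemma corestrict_comp X Y Z (f : chom Y Z) (g : chom X Y) :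
  corestrict_map (ccomp f g) = ccomp (corestrict_map f) (corestrict_map g).
Proof. exact/sig_val_inj/fmor_comp. Qed.
Definition corestrict : functor C (wide_subcat w) :=
  Functor corestrict_id corestrict_comp.
End Corestriction.
Arguments full_image_of {C D} F X.

Section DiffSp.
Variable R : realType.
Lemma ds_morphism_id (S : diffspace R) : ds_morphism (@id S).
Proof. by split=> // x; exact: cvg_id. Qed.
Lemma ds_morphism_comp (S T U : diffspace R) (f : T -> U) (g : S -> T) :
  ds_morphism f -> ds_morphism g -> ds_morphism (f \o g).
Proof.
move=> [cf Cf] [cg Cg]; split=> [x|phi Cphi].
  by apply: continuous_comp; [exact: cg|exact: cf].
exact/(Cg (phi \o f))/Cf.
Qed.
Definition ds_hom (S T : diffspace R) := {f : S -> T | ds_morphism f}.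
Definition ds_idm (S : diffspace R) : ds_hom S S :=
  exist _ id (ds_morphism_id S).
Definition ds_comp (S T U : diffspace R) (f : ds_hom T U)
    (g : ds_hom S T) : ds_hom S U :=
  exist _ (sval f \o sval g) (ds_morphism_comp (svalP f) (svalP g)).
Lemma ds_idl (S T : diffspace R) (f : ds_hom S T) :
  ds_comp (ds_idm T) f = f.
Proof. exact: sig_val_inj. Qed.
Lemma ds_idr (S T : diffspace R) (f : ds_hom S T) :
  ds_comp f (ds_idm S) = f.
Proof. exact: sig_val_inj. Qed.
Lemma ds_compA (S T U V : diffspace R) (f : ds_hom U V)
    (g : ds_hom T U) (h : ds_hom S T) :
  ds_comp f (ds_comp g h) = ds_comp (ds_comp f g) h.
Proof. exact: sig_val_inj. Qed.
Definition DiffSp : category := Category ds_idl ds_idr ds_compA.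
End DiffSp.

Section Germs.
Context {R : realType}.

(* The germ of f at x, as an equivalence class of functions. *)
Definition germ (T : topologicalType) (x : T) (f : T -> R) : set (T -> R) :=
  [set g | \forall y \near x, g y = f y].

(* The algebra of germs at x of elements of C; its operations are induced by
   those of functions. *)
Definition germs (T : topologicalType) (x : T) (C : set (T -> R)) :
    set (set (T -> R)) := germ x @` C.

(* Derivations of the algebra of germs C_x into R; only the values on C_x are
   relevant. *)
Definition is_derivation (S : diffspace R) (x : S) (v : set (S -> R) -> R) :=
  (forall a f g, ds_fun f -> ds_fun g ->
     v (germ x (fun y => a * f y + g y)) = a * v (germ x f) + v (germ x g)) /\
  (forall f g, ds_fun f -> ds_fun g ->
     v (germ x (fun y => f y * g y)) =
     f x * v (germ x g) + g x * v (germ x f)).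

(* dim T_x S <= k, i.e. T_x S is spanned by k derivations *)
Definition tangent_dim_le (S : diffspace R) (x : S) (k : nat) :=
  exists2 e : 'I_k -> set (S -> R) -> R, forall i, is_derivation x (e i) &
    forall v, is_derivation x v -> exists c : 'I_k -> R,
      forall gam, germs x (@ds_fun R S) gam -> v gam = \sum_(i < k) c i * e i gam.

Definition skeleton (S : diffspace R) (k : nat) : set S :=
  [set x | tangent_dim_le x k].
Arguments skeleton : clear implicits.

Definition stratum (S : diffspace R) (k : nat) : set S :=
  if k is j.+1 then skeleton S j.+1 `\` skeleton S j else skeleton S 0.
Arguments stratum : clear implicits.

End Germs.
Arguments skeleton {R} S k.
Arguments stratum {R} S k.

Section Manifolds.
Context {R : realType}.

(* A chart is a domain with a map, of which only the restriction to the domain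
   is relevant. *)
Definition chart (T : Type) (k : nat) : Type := (set T * (T -> 'rV[R]_k))%type.

(* The map is a homeomorphism from the domain, which is open, onto an open
   subset of R^k. *)
Definition is_chart (T : topologicalType) (k : nat) (c : chart T k) :=
  [/\ open c.1, forall x, c.1 x -> {for x, continuous c.2}, set_inj c.1 c.2 &
      forall V, open V -> V `<=` c.1 -> open (c.2 @` V)].

Definition is_smooth_atlas (T : topologicalType) (k : nat)
    (A : set (chart T k)) :=
  [/\ forall c, A c -> is_chart c,
      forall x, exists2 c, A c & c.1 x &
      forall c d, A c -> A d -> exists2 t : 'rV[R]_k -> 'rV[R]_k,
        smooth_on (c.2 @` (c.1 `&` d.1)) t &
        forall x, c.1 x -> d.1 x -> d.2 x = t (c.2 x)].

Definition is_smooth_manifold (T : topologicalType) (k : nat)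
    (A : set (chart T k)) :=
  [/\ hausdorff_space T, @second_countable T & is_smooth_atlas A].

Definition Cinfty (T : topologicalType) (k : nat) (A : set (chart T k)) :
    set (T -> R) :=
  [set f | forall c, A c -> exists2 t : 'rV[R]_k -> R,
     smooth_on (c.2 @` c.1) t & forall x, c.1 x -> f x = t (c.2 x)].

(* The map of germs rho is compatible with the algebra operations, since these
   are defined on representatives. *)
Definition is_stratum_structure (S : diffspace R) (k : nat)
    (A : set (chart (stratum S k) k)) :=
  is_smooth_manifold A /\
  forall x : stratum S k,
    exists rho : set (S -> R) -> set (stratum S k -> R),
      (forall f, ds_fun f -> rho (germ (set_val x) f) = germ x (f \o set_val)) /\
      set_bij (germs (set_val x) (@ds_fun R S)) (germs x (Cinfty A)) rho.

End Manifolds.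

Record is_stratifold (R : realType) (S : diffspace R) : Prop := IsStratifold {
  st_locally_compact : locally_compact [set: S];
  st_hausdorff : hausdorff_space S;
  st_countable_basis : @second_countable S;
  st_skeleton_closed : forall k, closed (skeleton S k);
  st_bump : forall (x : S) (U : set S), open U -> U x ->
    exists2 rho, ds_fun rho &
      [/\ forall y, 0 <= rho y, rho x != 0 &
          closure [set y | rho y != 0] `<=` U];
  st_stratum : forall k, exists A, @is_stratum_structure R S k A;
  st_finite_dim : exists n, skeleton S n = setT }.

Definition Stfd (R : realType) : category :=
  @full_subcat (DiffSp R) (@is_stratifold R).

(* By the isomorphism of germs, all choices of A have the same smooth
   functions. *)
Definition stratum_atlas (R : realType) (S : Stfd R) (k : nat) :
    set (chart (stratum (sval S) k) k) :=
  sval (cid (st_stratum (svalP S) k)).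
Arguments stratum_atlas {R} S k.

Record local_retraction (R : realType) (S : diffspace R) (i : nat) (x : S) :=
  LocalRetraction {
    lr_dom : set S;
    lr_open : open lr_dom;
    lr_mem : lr_dom x;
    lr_map : subds lr_dom -> subds (lr_dom `&` stratum S i);
    lr_morphism : ds_morphism lr_map;
    lr_id : forall u : lr_dom, stratum S i (set_val u) ->
      set_val (lr_map u) = set_val u }.

Arguments lr_map {R S i x} _ _.

Definition admissible (R : realType) (S S' : Stfd R)
    (f : sval S -> sval S') :=
  [/\ continuous f,
      forall x, exists i j, stratum (sval S) i x /\ stratum (sval S') j (f x) /\
        exists (r : local_retraction i x) (r' : local_retraction j (f x)),
          \forall y \near x,
            exists (u : lr_dom r) (v w : lr_dom r'),
              [/\ set_val u = y, set_val v = f (set_val (lr_map r u)),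
                  set_val w = f y &
                  lr_map r' v = lr_map r' w] &
      forall phi : sval S' -> R, ds_fun phi -> forall i,
        Cinfty (stratum_atlas S i)
          (fun y : stratum (sval S) i => phi (f (set_val y)))].

Record diffeology (R : realType) := Diffeology {
  dfl_car :> Type;
  plot : forall (q : nat) (U : set 'rV[R]_q), (U -> dfl_car) -> Prop;
  plot_open : forall q (U : set 'rV[R]_q) (u : U -> dfl_car),
    plot u -> open U;
  plot_cst : forall q (U : set 'rV[R]_q) (x : dfl_car),
    open U -> plot (fun _ : U => x);
  plot_local : forall q (U : set 'rV[R]_q) (u : U -> dfl_car), open U ->
    (forall x : U, exists (V : set 'rV[R]_q) (VU : V `<=` U),
       V (set_val x) /\ plot (u \o subset_incl VU)) ->
    plot u;
  plot_comp : forall p q (V : set 'rV[R]_p) (U : set 'rV[R]_q)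
      (u : U -> dfl_car) (h : V -> U), open V ->
    smooth_map (set_val \o h) -> plot u -> plot (u \o h) }.

Definition dfl_morphism (R : realType) (X Y : diffeology R) (f : X -> Y) :=
  forall q (U : set 'rV[R]_q) (u : U -> X), plot u -> plot (f \o u).

Section DiffeologyCat.
Variable R : realType.
Lemma dfl_morphism_id (X : diffeology R) : dfl_morphism (@id X).
Proof. by []. Qed.
Lemma dfl_morphism_comp (X Y Z : diffeology R) (f : Y -> Z) (g : X -> Y) :
  dfl_morphism f -> dfl_morphism g -> dfl_morphism (f \o g).
Proof. by move=> df dg q U u /dg/df. Qed.
Definition dfl_hom (S T : diffeology R) := {f : S -> T | dfl_morphism f}.
Definition dfl_idm (S : diffeology R) : dfl_hom S S :=
  exist _ id (@dfl_morphism_id S).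
Definition dfl_comp (S T U : diffeology R) (f : dfl_hom T U)
    (g : dfl_hom S T) : dfl_hom S U :=
  exist _ (sval f \o sval g) (dfl_morphism_comp (svalP f) (svalP g)).
Lemma dfl_idl (S T : diffeology R) (f : dfl_hom S T) :
  dfl_comp (dfl_idm T) f = f.
Proof. exact: sig_val_inj. Qed.
Lemma dfl_idr (S T : diffeology R) (f : dfl_hom S T) :
  dfl_comp f (dfl_idm S) = f.
Proof. exact: sig_val_inj. Qed.
Lemma dfl_compA (S T U V : diffeology R) (f : dfl_hom U V)
    (g : dfl_hom T U) (h : dfl_hom S T) :
  dfl_comp f (dfl_comp g h) = dfl_comp (dfl_comp f g) h.
Proof. exact: sig_val_inj. Qed.
Definition DiffeologyCat : category := Category dfl_idl dfl_idr dfl_compA.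
End DiffeologyCat.

Section DC.
Context {R : realType} (S : diffspace R).

Definition DC_plot (q : nat) (U : set 'rV[R]_q) (u : U -> S) :=
  open U /\ forall phi, ds_fun phi -> smooth_map (phi \o u).

Lemma DC_plot_cst q (U : set 'rV[R]_q) (x : S) :
  open U -> DC_plot (fun _ : U => x).
Proof.
move=> oU; split=> // phi _; exists (fun _ => phi x) => // n.
exact: Ck_on_cst.
Qed.

Lemma DC_plot_local q (U : set 'rV[R]_q) (u : U -> S) : open U ->
  (forall x : U, exists (V : set 'rV[R]_q) (VU : V `<=` U),
     V (set_val x) /\ DC_plot (u \o subset_incl VU)) ->
  DC_plot u.
Proof.
move=> oU lu; split=> // phi Cphi.
pose g (x : 'rV[R]_q) : R :=
  if pselect (U x) is left Ux then phi (u (exist _ x (mem_set Ux))) else 0.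
have gE (x : U) : phi (u x) = g (set_val x).
  rewrite /g; case: pselect => [Ux|]; last by case; exact: set_mem (svalP x).
  by congr (phi (u _)); exact: val_inj.
exists g => // n; apply: Ck_on_local => x Ux.
have [V [VU [Vx [oV /(_ phi Cphi)[h sh uh]]]]] := lu (exist _ x (mem_set Ux)).
exists V => //; apply: Ck_on_ext (sh n) => // y Vy.
by rewrite -(gE (exist _ y (mem_set (VU _ Vy)))) -(uh (exist _ y (mem_set Vy)))
  /=; congr (phi (u _)); exact: val_inj.
Qed.

Lemma DC_plot_comp p q (V : set 'rV[R]_p) (U : set 'rV[R]_q)
    (u : U -> S) (h : V -> U) : open V ->
  smooth_map (set_val \o h) -> DC_plot u -> DC_plot (u \o h).
Proof.
move=> oV [g sg hg] [oU su]; split=> // phi /su[t st ut].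
exists (t \o g) => [n|x].
  apply: (Ck_on_comp oV oU) => // x Vx.
  by rewrite -(hg (exist _ x (mem_set Vx))); exact: set_mem (svalP (h _)).
by have := ut (h x); rewrite -[set_val (h x)]/((set_val \o h) x) hg.
Qed.

Definition DC : diffeology R := @Diffeology R S DC_plot
  (fun q U u pu => pu.1) DC_plot_cst DC_plot_local DC_plot_comp.

End DC.

Section FunctorK.
Variable R : realType.
Lemma ds_dfl_morphism (S T : diffspace R) (f : S -> T) :
  ds_morphism f -> @dfl_morphism R (DC S) (DC T) f.
Proof. by move=> [_ Cf] q U u [oU su]; split=> // phi /Cf/su. Qed.

Definition k_map (S T : Stfd R) (f : chom S T) :
    @chom (DiffeologyCat R) (DC (sval S)) (DC (sval T)) :=
  exist _ (sval f) (ds_dfl_morphism (svalP f)).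

Lemma k_map_id (S : Stfd R) :
  k_map (cidm S) = @cidm (DiffeologyCat R) (DC (sval S)).
Proof. exact: sig_val_inj. Qed.
Lemma k_map_comp (S T U : Stfd R) (f : chom T U) (g : chom S T) :
  k_map (ccomp f g) = @ccomp (DiffeologyCat R) _ _ _ (k_map f) (k_map g).
Proof. exact: sig_val_inj. Qed.

Definition k_functor : functor (Stfd R) (DiffeologyCat R) :=
  @Functor (Stfd R) (DiffeologyCat R) (fun S => DC (sval S)) k_map
    k_map_id k_map_comp.
End FunctorK.

(* f, regarded as a map between the underlying sets of the stratifolds that X
   and Y come from, is admissible. *)
Definition admissible_hom (R : realType) (X Y : full_image (k_functor R))
    (f : chom X Y) :=
  @admissible R (im_src X) (im_src Y)
    (sval (@hom_transport (DiffeologyCat R) _ _ _ _ (im_eq X) (im_eq Y) f)).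

(* Main.v *)
Require Import Defs.
From mathcomp Require Import all_boot all_order all_algebra.
From mathcomp Require Import all_classical all_reals all_analysis.
From mathcomp Require Import ring lra.

(* A map between stratifolds is admissible if and only if it is a morphism of
   differential spaces; granting this, the theorem is formal.

   If r and r' are local retractions near x and f(x), injectivity of the germ
   maps C_x -> C^oo(S^i)_x gives phi = phi o r' near f(x) and g = g o r near x.
   For f admissible and phi in C', this yields
     phi o f = phi o r' o f = phi o r' o f o r = phi o f o r = g o r = g
   near x, where g in C extends the germ of the smooth function (phi o f)|S^i.

   Conversely, near a point of a stratum S^k, germ surjectivity extends the
   coordinates of a chart c to functions a = (a_1, ..., a_k) in C, and
   c^-1 o a is a local retraction. For a morphism f, both r' o f o r and r' o f
   have the same coordinates a' (as a' o r' = a' and a' o f o r = a' o f near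
   the points in question), hence they agree since a' is injective on the
   stratum. *)

Set Implicit Arguments.
Unset Strict Implicit.
Unset Printing Implicit Defensive.
Import Order.TTheory GRing.Theory Num.Theory.
Import numFieldNormedType.Exports.
Local Open Scope classical_set_scope.
Local Open Scope ring_scope.

(** * A smooth step function on the real line *)

Section SmoothStep.
Context {R : realType}.

(* The derivative of [flat n] is [flat n.+2 - n *: flat n.+1], so smoothness of
   the whole family follows by induction. *)
Definition flat (n : nat) (t : R) : R :=
  if 0 < t then t^-1 ^+ n * expR (- t^-1) else 0.

Lemma flat_le n t : `|flat n t| <= n.+2`!%:R * t ^+ 2.
Proof.
rewrite /flat; case: ifPn => [t0|_]; last by rewrite normr0 mulr_ge0 ?sqr_ge0.
have u0 : 0 <= t^-1 by rewrite invr_ge0 ltW.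
have K0 : 0 < n.+2`!%:R :> R by rewrite ltr0n fact_gt0.
rewrite ger0_norm ?mulr_ge0 ?exprn_ge0 ?expR_ge0// expRN.
rewrite ler_pdivrMr ?expR_gt0//.
have /(ler_wpM2l (mulr_ge0 (ltW K0) (sqr_ge0 t))) :
    t^-1 ^+ n.+2 / n.+2`!%:R <= expR t^-1.
  by apply: le_trans (expR_ge1Dxn n.+1 u0); rewrite lerDr.
apply: le_trans; rewrite [_%:R * _]mulrC -mulrA [_%:R * _]mulrC divfK ?gt_eqF//.
by rewrite -[n.+2]addn2 exprD mulrCA -exprMn mulfV ?gt_eqF// expr1n mulr1.
Qed.

Lemma flat_npos n t : t <= 0 -> flat n t = 0.
Proof. by rewrite leNgt /flat => /negbTE ->. Qed.

Lemma is_derive_flat n (t : R) :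
  is_derive t (1 : R) (flat n) (flat n.+2 t - n%:R * flat n.+1 t).
Proof.
have [t0|t0|<-] := ltgtP 0 t.
- have tn : t != 0 by rewrite gt_eqF.
  have dV : is_derive t (1:R) (fun x : R => x^-1) (- t ^- 2).
    have := @is_deriveV R id t 1 1 tn _.
    by rewrite /GRing.scale /= mulr1; apply.
  have dN : is_derive t (1:R) (fun x : R => - x^-1) (t ^- 2).
    by apply: is_derive_eq (is_deriveN dV) _; rewrite opprK.
  have dE : is_derive t (1:R) (fun x : R => expR (- x^-1))
     (expR (- t^-1) * t ^- 2).
    exact: is_derive1_comp.
  have dX := is_deriveX n dV.
  have d1 : is_derive t (1:R) (fun x : R => x^-1 ^+ n * expR (- x^-1))
     (flat n.+2 t - n%:R * flat n.+1 t).
    have := is_deriveM dX dE.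
    have -> : (fun x : R => x^-1) ^+ n * (fun x : R => expR (- x^-1)) =
      (fun x : R => x^-1 ^+ n * expR (- x^-1)).
      by apply/funext => x /=; rewrite fctE exprfctE.
    move=> h; apply: is_derive_eq h _.
    rewrite exprfctE /flat t0 /GRing.scale /=.
    have -> : t ^- 2 = t^-1 ^+ 2 by rewrite exprVn.
    (* The derivative of the [n]-th power involves the exponent [n.-1], so [n = 0] is separate. *)
    case: (n) => [|m] /=; first by rewrite !mul0r mulr0 addr0 subr0 mul1r mulrC.
    rewrite !exprS; ring.
  apply: near_eq_is_derive d1.
  near=> y; rewrite /flat ifT//.
  by near: y; exact: lt_nbhsr.
- rewrite !flat_npos ?ltW// mulr0 subr0.
  have := is_derive_cst (0 : R) t (1 : R); apply: near_eq_is_derive.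
  near=> y; rewrite flat_npos//= ltW//.
  by near: y; exact: lt_nbhsl.
- rewrite {2 3}/flat ltxx mulr0 subr0.
  have d0 : h^-1 *: (flat n (h *: 1 + 0) - flat n 0) @[h --> 0^'] --> (0 : R).
    apply/cvgr0Pnorm_le => e e0; near=> h.
    have h0 : h != 0 by near: h; exact: nbhs_dnbhs_neq.
    rewrite {2}/flat ltxx subr0 addr0 [h *: 1]mulr1 normrZ normfV.
    rewrite ler_pdivrMl ?normr_gt0//; apply: le_trans (flat_le n h) _.
    rewrite -real_normK ?num_real// expr2 mulrA mulrC ler_wpM2l//.
    rewrite -ler_pdivlMl ?ltr0n ?fact_gt0//.
    near: h; apply: dnbhs0_le; rewrite mulr_gt0 ?invr_gt0 ?ltr0n ?fact_gt0//.
  by apply: DeriveDef; [apply/cvg_ex; exists 0|exact: cvg_lim].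
Unshelve. all: by end_near.
Qed.

Lemma flat_gt0 n t : (0 < flat n t) = (0 < t).
Proof.
rewrite /flat; case: ifPn => [t0|]; last by rewrite ltxx.
by rewrite mulr_gt0 ?exprn_gt0 ?invr_gt0 ?expR_gt0.
Qed.

Lemma le_flat0 s t : s <= t -> flat 0 s <= flat 0 t.
Proof.
move=> st; rewrite /flat; case: ifPn => [s0|_]; last first.
  by case: ifP => // t0; rewrite mulr_ge0 ?expR_ge0.
rewrite (lt_le_trans s0 st) !expr0 !mul1r ler_expR lerN2 lef_pV2 ?posrE//.
exact: lt_le_trans st.
Qed.

Lemma Ck_on_flat (V : normedModType R) (U : set V) n m (h : V -> R) : open U ->
  Ck_on U m h -> Ck_on U m (flat n \o h).
Proof.
move=> oU; have df j t : differentiable (flat j) t.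
  by apply/derivable1_diffP; have [] := is_derive_flat j t.
(* The index [n] stays general, since differentiating raises it while lowering the order [m]. *)
elim: m n h => [|m IH] n h Ch.
  move=> x Ux; apply: continuous_comp; first exact: Ch.
  exact/differentiable_continuous.
have [dh Dh] := Ch; split=> [x Ux|v].
  by apply: differentiable_comp; [exact: dh|].
apply: (@Ck_on_ext _ _ _ _ _
  (fun x => (flat n.+2 (h x) + (- n%:R) * flat n.+1 (h x)) * 'D_v h x)) => //.
  move=> x Ux; have dhx := dh x Ux.
  rewrite [RHS](deriveE v (differentiable_comp dhx (df n (h x)))) diff_comp //=.
  rewrite -(deriveE v dhx) diff1E// derive1E.
  have [_ ->] := is_derive_flat n (h x).
  by rewrite mulNr mulrC.
apply: Ck_onM (Dh v) => //; apply: Ck_onD => //; first exact/IH/Ck_onW.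
by apply: Ck_onM => //; [exact: Ck_on_cst|exact/IH/Ck_onW].
Qed.

(* The nesting replaces the usual quotient [flat t / (flat t + flat (1 - t))],
   so that smoothness needs only composition with [flat 0]. *)
Definition smooth_step (t : R) : R :=
  (flat 0 (flat 0 1))^-1 * flat 0 (flat 0 1 - flat 0 (1 - t)).

Lemma smooth_step_ge1 t : 1 <= t -> smooth_step t = 1.
Proof.
move=> t1; rewrite /smooth_step (@flat_npos 0 (1 - t)) ?subr_le0//.
by rewrite subr0 mulVf// gt_eqF// !flat_gt0.
Qed.

(** Monotonicity of [flat 0] gives [flat 0 1 <= flat 0 (1 - t)], so the outer [flat 0] is evaluated
    at a non-positive number. *)
Lemma smooth_step_npos t : t <= 0 -> smooth_step t = 0.
Proof.
move=> t0; rewrite /smooth_step [X in _ * X]flat_npos ?mulr0//.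
by rewrite subr_le0 le_flat0// lerDl oppr_ge0.
Qed.

Lemma smooth_on_smooth_step (V : normedModType R) (U : set V) (h : V -> R) :
  open U -> smooth_on U h -> smooth_on U (smooth_step \o h).
Proof.
move=> oU sh n; apply: Ck_onM => //; first exact: Ck_on_cst.
apply: (@Ck_on_flat _ _ 0 n (fun x => flat 0 1 - flat 0 (1 - h x))) => //.
have sub (a : R) (g : V -> R) : Ck_on U n g -> Ck_on U n (fun x => a - g x).
  move=> Cg; apply: (@Ck_onD _ _ _ _ n (cst a) (fun x => - g x)) => //.
    exact: Ck_on_cst.
  under [X in Ck_on _ _ X]eq_fun do rewrite -mulN1r.
  by apply: Ck_onM => //; exact: Ck_on_cst.
apply: (sub); apply: (@Ck_on_flat _ _ 0 n (fun x => 1 - h x)) => //.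
exact: sub.
Qed.

End SmoothStep.

(** * Smooth functions on open sets and their cutoffs *)

Section Cutoff.
Context {R : realType}.

Lemma smooth_onS (V W : normedModType R) (U U' : set V) (f : V -> W) :
  U' `<=` U -> smooth_on U f -> smooth_on U' f.
Proof. by move=> UU' sf n; apply: Ck_on_local => x /UU' Ux; exists U. Qed.

Lemma smooth_on_local (V W : normedModType R) (U : set V) (f : V -> W) :
  (forall x, U x -> exists2 U' : set V, U' x & smooth_on U' f) -> smooth_on U f.
Proof. by move=> sf n; apply: Ck_on_local => x /sf[U' U'x]; exists U'. Qed.

Lemma smooth_on_ext (V W : normedModType R) (U : set V) (f g : V -> W) :
  open U -> (forall x, U x -> f x = g x) -> smooth_on U f -> smooth_on U g.
Proof. by move=> oU fg sf n; exact: Ck_on_ext (sf n). Qed.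

Lemma smooth_on_comp (V : normedModType R) q (U : set V) (U' : set 'rV[R]_q)
    (h : V -> 'rV[R]_q) (f : 'rV[R]_q -> R) : open U -> open U' ->
  (forall x, U x -> U' (h x)) ->
  smooth_on U h -> smooth_on U' f -> smooth_on U (f \o h).
Proof. by move=> oU oU' hU sh sf n; exact: Ck_on_comp (sh n) (sf n). Qed.

Lemma smooth_onM (V : normedModType R) (U : set V) (f g : V -> R) :
  open U -> smooth_on U f -> smooth_on U g -> smooth_on U (fun x => f x * g x).
Proof. by move=> oU sf sg n; exact: Ck_onM. Qed.

Lemma smooth_on_id (V : normedModType R) (U : set V) :
  smooth_on U (@id V).
Proof.
case=> [|n] /=; first by move=> x _; exact: cvg_id.
split=> [x _|v]; first by [].
have -> : (fun x => 'D_v id x) = (fun=> v).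
  by apply/funext => x; exact: derive_id.
exact: Ck_on_cst.
Qed.

Lemma smooth_on_row q (U : set 'rV[R]_q) j : open U ->
  smooth_on U (fun x : 'rV[R]_q => x 0 j).
Proof. by move=> oU n; exact/(Ck_on_coord _ oU)/smooth_on_id. Qed.

(** Structure algebras are closed under composition with functions smooth on all of R^n, whereas
    chart expressions are smooth only on an open set. Multiplying by a bump function at [p] bridges
    the gap without changing the germ. *)
Lemma smooth_cutoff q (U : set 'rV[R]_q) (p : 'rV[R]_q) (f : 'rV[R]_q -> R) :
  open U -> U p -> smooth_on U f ->
  exists2 g, smooth_on setT g & \forall x \near p, g x = f x.
Proof.
move=> oU Up sf.
have /nbhs_ballP[e /= e0 eU] : nbhs p U by exact: open_nbhs_nbhs.
have e2 : 0 < e ^+ 2 by rewrite exprn_gt0.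
(* The squared Euclidean distance is smooth, unlike the max norm defining the balls; it dominates
   the square of each coordinate difference. *)
pose d (x : 'rV[R]_q) := \sum_(j < q) (x 0 j + - p 0 j) * (x 0 j + - p 0 j).
have sd : smooth_on setT d.
  move=> n; apply: Ck_on_sum => [|j]; first exact: openT.
  suff : Ck_on setT n (fun x : 'rV[R]_q => x 0 j + - p 0 j).
    by move=> h; apply: Ck_onM => //; exact: openT.
  apply: Ck_onD; first exact: openT; last exact: Ck_on_cst.
  exact: (smooth_on_row j openT n).
have cd : continuous d by move=> x; exact: (sd 0 x).
have dU : [set x | d x < e ^+ 2] `<=` U.
  move=> x /= dx; apply: eU; split=> // i j; rewrite ord1 /ball /=.
  rewrite -ltr_sqr ?nnegrE ?normr_ge0 ?(ltW e0)//.
  rewrite real_normK ?num_real//; apply: le_lt_trans dx.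
  rewrite /d (bigD1 j)//= -sqrrN opprB expr2 lerDl sumr_ge0// => l _.
  by rewrite -expr2 sqr_ge0.
(* The constants make [b] equal to 1 where [d <= e ^+ 2 / 4] and to 0 where [d >= e ^+ 2 / 2]. *)
pose b (x : 'rV[R]_q) := smooth_step (2 + (- (4 / e ^+ 2)) * d x).
have sb : smooth_on setT b.
  apply: (@smooth_on_smooth_step _ _ _ (fun x => 2 + (- (4 / e ^+ 2)) * d x)).
    exact: openT.
  move=> n; apply: Ck_onD; [exact: openT|exact: Ck_on_cst|].
  by apply: Ck_onM; [exact: openT|exact: Ck_on_cst|exact: sd].
exists (fun x => b x * f x).
  (* The open sets [d < e ^+ 2], inside [U], and [e ^+ 2 / 2 < d], where the product vanishes, cover
     the space. *)
  apply: smooth_on_local => x _; have [dx|dx] := ltP (d x) (e ^+ 2).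
    exists [set x | d x < e ^+ 2] => //.
    have od : open [set x | d x < e ^+ 2].
      by apply: (@open_comp _ _ d (fun t => t < e ^+ 2)).
    by apply: smooth_onM; [|exact: smooth_onS sb|exact: smooth_onS sf].
  exists [set x | e ^+ 2 / 2 < d x] => /=; first by lra.
  have od : open [set x | e ^+ 2 / 2 < d x].
    by apply: (@open_comp _ _ d (fun t => e ^+ 2 / 2 < t)).
  apply: (@smooth_on_ext _ _ _ (fun=> 0)) => // [y /= dy|n].
    2: exact: Ck_on_cst.
  rewrite /b smooth_step_npos ?mul0r// mulNr subr_le0 mulrAC ler_pdivlMr//.
  lra.
have : \forall x \near p, d x < e ^+ 2 / 4.
  apply: (cd p [set t | t < e ^+ 2 / 4]); apply: lt_nbhsl.
  by rewrite /d big1 ?divr_gt0// => j _; rewrite subrr mul0r.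
apply: filterS => x dx; rewrite /b smooth_step_ge1 ?mul1r//.
rewrite mulNr lerBrDr -lerBrDl mulrAC ler_pdivrMr//; lra.
Qed.

End Cutoff.

(** * Neighborhoods and continuity in subspaces *)

Section Subtype.
Context (T : topologicalType).

(** Quantifying over all [z] above [y] lets subspace neighborhoods be intersected with ambient ones
    before membership of [y] in [Y] is known. *)
Lemma nbhs_subtypeP (Y : set T) (x : Y) (P : set Y) :
  nbhs x P <-> \forall y \near set_val x, forall z : Y, set_val z = y -> P z.
Proof.
split.
  rewrite nbhsE /= => -[B [[C oC <-] /= Cx] CP].
  apply: filterS (open_nbhs_nbhs (conj oC Cx)) => y Cy z zy.
  by apply: CP => /=; rewrite zy.
move=> h.
have : nbhs x (set_val @^-1` [set y | forall z : Y, set_val z = y -> P z]).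
  exact: initial_continuous h.
by apply: filterS => z /(_ z erefl).
Qed.

Lemma continuous_subtype (Z : topologicalType) (Y : set T) (f : Z -> Y) x :
  {for x, continuous (set_val \o f)} -> {for x, continuous f}.
Proof.
move=> cf P /nbhs_subtypeP /cf; rewrite /nbhs /=.
by apply: filterS => z; exact.
Qed.

End Subtype.

(** * Smooth functions on a manifold with an atlas *)

Section ManifoldFunctions.
Context {R : realType} (T : topologicalType) (k : nat) (A : set (@chart R T k)).
Hypothesis atlasA : is_smooth_atlas A.

Lemma chart_image_open (c : chart T k) V : A c -> open V -> V `<=` c.1 ->
  open (c.2 @` V).
Proof. by case: atlasA => + _ _ => /[apply] -[_ _ _]; apply. Qed.

Lemma chart_inj (c : chart T k) x y : A c -> c.1 x -> c.1 y -> c.2 x = c.2 y ->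
  x = y.
Proof.
case: atlasA => + _ _ => /[apply] -[_ _ + _] cx cy; apply; exact: mem_set.
Qed.

(** One chart around each point suffices: transition maps carry the local expression [t] into any
    other chart of the atlas. *)
Lemma Cinfty_local (f : T -> R) :
  (forall x, exists c V t, [/\ A c, open V, V x & V `<=` c.1] /\
     (smooth_on (c.2 @` V) t /\ forall y, V y -> f y = t (c.2 y))) ->
  Cinfty A f.
Proof.
have [chA _ trA] := atlasA => lf d Ad.
have [od _ _ _] := chA _ Ad.
(* This is [f] read in the chart [d], with default value 0 off its image; injectivity of the chart
   makes the chosen preimage immaterial. *)
pose g (p : 'rV[R]_k) : R :=
  if pselect (exists2 z, d.1 z & d.2 z = p) is left h then f (sval (cid2 h))
  else 0.
have gE z : d.1 z -> f z = g (d.2 z).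
  move=> dz; rewrite /g; case: pselect => [h|]; last by case; exists z.
  by case: cid2 => y /= dy /(chart_inj Ad dy dz) ->.
exists g => //; apply: smooth_on_local => _ [x dx <-].
have [c [V [t [[Ac oV Vx Vc] [st ft]]]]] := lf x.
have [tau stau dc] := trA _ _ Ad Ac.
have oW : open (d.2 @` (d.1 `&` V)).
  by apply: chart_image_open => //; exact: openI.
exists (d.2 @` (d.1 `&` V)); first by exists x.
apply: (@smooth_on_ext _ _ _ _ (t \o tau)) => //.
  by move=> _ [y [dy Vy] <-] /=; rewrite -gE// ft// dc//; exact: Vc.
apply: smooth_on_comp st => //; first exact: chart_image_open.
  by move=> _ [y [dy Vy] <-]; exists y => //; rewrite dc//; exact: Vc.
apply: smooth_onS stau => _ [y [dy Vy] <-].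
by exists y => //; split=> //; exact: Vc.
Qed.

Lemma Cinfty_near (f : T -> R) :
  (forall x : T, exists2 g, Cinfty A g & \forall y \near x, f y = g y) ->
  Cinfty A f.
Proof.
have [chA covA _] := atlasA => lf; apply: Cinfty_local => x.
have [c Ac cx] := covA x; have [g /(_ c Ac)[t st gt]] := lf x.
have [oc _ _ _] := chA _ Ac.
rewrite -nbhs_nearE nbhsE => -[V [oV Vx] Vfg].
exists c, (c.1 `&` V), t; split; first by split=> //; exact: openI.
split; last by move=> y [cy Vy]; rewrite Vfg// gt.
by apply: smooth_onS st => _ [y [cy _] <-]; exists y.
Qed.

(** A coordinate is meaningful only on the chart domain; since the support of [b] lies there, the
    product vanishes near every point outside. *)
Lemma Cinfty_mul_coord (c : chart T k) (b : T -> R) j : A c -> Cinfty A b ->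
  closure [set y | b y != 0] `<=` c.1 ->
  Cinfty A (fun y => b y * c.2 y 0 j).
Proof.
have [chA covA _] := atlasA => Ac Cb bc; apply: Cinfty_local => x.
have [oc _ _ _] := chA _ Ac.
have [cx|ncx] := pselect (c.1 x).
  have [t st bt] := Cb c Ac.
  have oW : open (c.2 @` c.1) by exact: chart_image_open.
  exists c, c.1, (fun p => t p * p 0 j); split; [by split|split].
    exact: (smooth_onM oW st (smooth_on_row j oW)).
  by move=> y cy; rewrite bt.
have [d Ad dx] := covA x; have [od _ _ _] := chA _ Ad.
exists d, (d.1 `&` ~` closure [set y | b y != 0]), (fun=> 0); split.
  split=> //; last by split=> // /bc.
  by apply: openI => //; exact/closed_openC/closed_closure.
split=> [n|y [_ /= nb]]; first exact: Ck_on_cst.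
have [->|b0] := eqVneq (b y) 0; first by rewrite mul0r.
by case: nb; exact: subset_closure.
Qed.

End ManifoldFunctions.

(** * Germs of structure functions along a stratum *)

Lemma germ_eqP (R : realType) (T : topologicalType) (x : T) (f g : T -> R) :
  germ x f = germ x g <-> \forall y \near x, f y = g y.
Proof.
split=> [fg|fg].
  have : germ x f f by apply: nearW.
  by rewrite fg.
by apply/seteqP; split=> h; apply: filterS2 fg => y ->.
Qed.

Section StratumGerms.
Context {R : realType} {S : diffspace R} {k : nat}.
Variable A : set (@chart R (stratum S k) k).
Hypothesis sA : is_stratum_structure A.

Lemma stratum_atlasP : is_smooth_atlas A.
Proof. by case: sA => -[]. Qed.

(** The germ map takes values in germs of smooth functions, so the restriction agrees with a smooth
    function near each point, and smoothness is local. *)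
Lemma Cinfty_restr f : ds_fun f -> Cinfty A (f \o set_val).
Proof.
move=> Cf; apply: (Cinfty_near stratum_atlasP) => x.
have [rho [rhoE [rhoF _ _]]] := sA.2 x.
have [|g Cg] := rhoF (germ (set_val x) f); first by exists f.
by rewrite rhoE// => /esym/germ_eqP fg; exists g.
Qed.

Lemma Cinfty_extend g (x : stratum S k) : Cinfty A g ->
  exists2 f, ds_fun f & \forall y \near x, f (set_val y) = g y.
Proof.
move=> Cg; have [rho [rhoE [_ _ rhoS]]] := sA.2 x.
have [|_ [f Cf <-]] := rhoS (germ x g); first by exists g.
by rewrite rhoE// => /germ_eqP fg; exists f.
Qed.

(** This is injectivity of the germ map, with agreement on the stratum phrased in ambient
    neighborhoods. *)
Lemma stratum_germ_inj f g (x : S) : stratum S k x -> ds_fun f -> ds_fun g ->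
  (\forall y \near x, stratum S k y -> f y = g y) ->
  \forall y \near x, f y = g y.
Proof.
move=> kx Cf Cg fg; pose x' : stratum S k := exist _ x (mem_set kx).
have [rho [rhoE [_ rhoI _]]] := sA.2 x'.
apply/germ_eqP/rhoI.
- by apply: mem_set; exists f.
- by apply: mem_set; exists g.
rewrite -[x]/(set_val x') !rhoE//; apply/germ_eqP/nbhs_subtypeP.
apply: filterS fg => y fg z zy; rewrite /= zy; apply: fg.
by rewrite -zy; exact: set_mem (svalP z).
Qed.

End StratumGerms.

(** * Structure functions built by smooth composition *)

Section DiffspaceFunctions.
Context {R : realType} {S : diffspace R}.

(** The case [n = 0], where the composite is constant, is included to cover strata of dimension
    0. *)
Lemma ds_smooth_row n (fs : 'I_n -> S -> R) (g : 'rV[R]_n -> R) :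
  (forall i, ds_fun (fs i)) -> smooth_on setT g ->
  ds_fun (fun x => g (\row_i fs i x)).
Proof.
case: n fs g => [|n] fs g Cfs sg; last exact: ds_smooth.
rewrite (_ : (fun _ => _) = cst (g 0)); first exact: ds_cst.
by apply/funext => x /=; congr g; apply/rowP => -[].
Qed.

Lemma row_continuous n (fs : 'I_n -> S -> R) : (forall i, ds_fun (fs i)) ->
  continuous (fun x => \row_i fs i x).
Proof.
move=> Cfs x; apply/cvg_ballP => e e0.
have nb : \forall y \near x, forall i, ball (fs i x) e (fs i y).
  apply: filter_forall => i; have := @ds_cont _ _ _ (Cfs i) x.
  by move=> /cvg_ballP/(_ e e0).
by apply: filterS nb => y yb; split=> // i j; rewrite !mxE.
Qed.

(** Composing [rho] with a rescaled [smooth_step] gives 1 wherever [rho] exceeds [rho x / 2], and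
    keeps the support since [smooth_step] vanishes at 0. *)
Lemma ds_bump : (forall (x : S) (U : set S), open U -> U x ->
    exists2 rho, ds_fun rho & [/\ forall y, 0 <= rho y, rho x != 0 &
      closure [set y | rho y != 0] `<=` U]) ->
  forall (x : S) (U : set S), open U -> U x -> exists b, [/\ ds_fun b,
    \forall y \near x, b y = 1 & closure [set y | b y != 0] `<=` U].
Proof.
move=> bump x U oU Ux; have [rho Crho [rho0 rhox rhoU]] := bump x U oU Ux.
have rx : 0 < rho x by rewrite lt0r rhox rho0.
exists (fun y => smooth_step (2 / rho x * rho y)); split.
- have := @ds_smooth_row 1 (fun=> rho)
    (fun p => smooth_step (2 / rho x * p 0 0)).
  under [X in _ -> _ -> ds_fun X]eq_fun do rewrite mxE.
  apply=> //.
  apply: (@smooth_on_smooth_step _ _ _ (fun p : 'rV[R]_1 => 2 / rho x * p 0 0)).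
    exact: openT.
  move=> n; apply: Ck_onM; [exact: openT|exact: Ck_on_cst|].
  exact: smooth_on_row openT n.
- have : \forall y \near x, rho x / 2 < rho y.
    apply: (@ds_cont _ _ _ Crho x [set t | rho x / 2 < t]).
    by apply: lt_nbhsr; lra.
  apply: filterS => y ry; rewrite smooth_step_ge1// mulrAC ler_pdivlMr//; lra.
- apply: subset_trans rhoU; apply: closure_subset => y /=.
  by apply: contra => /eqP ->; rewrite mulr0 smooth_step_npos.
Qed.

End DiffspaceFunctions.

(** * Local retractions built from charts *)

Section Retraction.
Context {R : realType} {S : diffspace R} {k : nat}.
Hypothesis bump : forall (x : S) (U : set S), open U -> U x ->
  exists2 rho, ds_fun rho & [/\ forall y, 0 <= rho y, rho x != 0 &
    closure [set y | rho y != 0] `<=` U].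
Variable A : set (@chart R (stratum S k) k).
Hypothesis sA : is_stratum_structure A.

(** Germ surjectivity applies to functions smooth on the whole stratum, so the coordinates are first
    multiplied by a bump function equal to 1 near [x]. *)
Lemma extend_coords (x : stratum S k) : exists (c : chart (stratum S k) k)
    (a : 'I_k -> S -> R),
  [/\ A c, c.1 x, forall j, ds_fun (a j) &
      \forall y \near x, \row_j a j (set_val y) = c.2 y].
Proof.
have atA := stratum_atlasP sA; have [chA covA _] := atA.
have [c Ac cx] := covA x; have [oc _ _ _] := chA _ Ac.
have [W oW Wc] := oc.
have Wx : W (set_val x) by have : (set_val @^-1` W) x by rewrite Wc.
have [b [Cb b1 bW]] := ds_bump bump oW Wx.
(* The closure within the stratum maps into the closure in [S], which lies in [W]. *)
have sc : closure [set y : stratum S k | b (set_val y) != 0] `<=` c.1.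
  move=> y cy; rewrite -Wc; apply: bW => B nB.
  have [z [bz Bz]] := cy (set_val @^-1` B)
    (@initial_continuous _ _ set_val y _ nB).
  by exists (set_val z).
have Cg j := Cinfty_mul_coord atA j Ac (Cinfty_restr sA Cb) sc.
have /choice[a aP] : forall j, exists a, ds_fun a /\
    \forall y \near x, a (set_val y) = b (set_val y) * c.2 y 0 j.
  by move=> j; have [a Ca ax] := Cinfty_extend sA x (Cg j); exists a.
exists c, a; split=> //; first by move=> j; have [] := aP j.
have na : \forall y \near x, forall j,
    a j (set_val y) = b (set_val y) * c.2 y 0 j.
  apply: (@filter_forall _ _
    (fun j y => a j (set_val y) = b (set_val y) * c.2 y 0 j) (nbhs x)) => j.
  by have [] := aP j.
have nb : \forall y \near x, b (set_val y) = 1.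
  exact: (@initial_continuous _ _ set_val x _ b1).
by apply: filterS2 na nb => y ay by1; apply/rowP => j; rewrite mxE ay by1 mul1r.
Qed.

(** The functions [a] are returned with the retraction because they separate points of the stratum
    in its domain, which later serves to prove two retracted points equal. *)
Lemma local_retraction_exists (x : S) : stratum S k x ->
  exists (r : local_retraction k x) (a : 'I_k -> S -> R),
    (forall j, ds_fun (a j)) /\
    forall u v, lr_dom r u -> lr_dom r v -> stratum S k u -> stratum S k v ->
      \row_j a j u = \row_j a j v -> u = v.
Proof.
move=> kx; pose x' : stratum S k := exist _ x (mem_set kx).
have atA := stratum_atlasP sA.
have [c [a [Ac cx Ca ac]]] := extend_coords x'.
have [oc _ _ _] : is_chart c by case: atA => + _ _; apply.
have : \forall y \near x', c.1 y /\ \row_j a j (set_val y) = c.2 y.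
  by apply: filterS2 (open_nbhs_nbhs (conj oc cx)) ac.
rewrite -nbhs_nearE nbhsE => -[V [oV Vx] VP].
have [W oW WV] := oV.
have VW z : V z <-> W (set_val z) by rewrite -WV.
have Vc : V `<=` c.1 by move=> z /VP[].
have Va z : V z -> \row_j a j (set_val z) = c.2 z by move=> /VP[].
pose av y := \row_j a j y.
have cav : continuous av by exact: row_continuous.
pose P := c.2 @` V; have oP : open P := chart_image_open atA Ac oV Vc.
(* The inverse of the chart on [V], with default [x'] outside [P]. *)
pose inv p : stratum S k :=
  if pselect (exists2 z, V z & c.2 z = p) is left h then sval (cid2 h) else x'.
have invP p : P p -> V (inv p) /\ c.2 (inv p) = p.
  by move=> Pp; rewrite /inv; case: pselect => // h; case: cid2.
have invK z : V z -> inv (c.2 z) = z.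
  move=> Vz; have [Vi ci] := invP (c.2 z) (ex_intro2 _ _ z Vz erefl).
  by apply: (chart_inj atA Ac _ _ ci); exact: Vc.
have cinv p : P p -> {for p, continuous inv}.
  move=> Pp B; rewrite nbhsE => -[B' [oB' B'p] B'B].
  have oI : open (c.2 @` (V `&` B')).
    apply: (chart_image_open atA Ac); first exact: openI.
    by move=> z [Vz _]; exact: Vc.
  have [Vp cp] := invP p Pp.
  have : nbhs p (c.2 @` (V `&` B')).
    by apply: open_nbhs_nbhs; split=> //; exists (inv p).
  by apply: filterS => _ [z [Vz B'z] <-]; apply: B'B; rewrite /= invK.
pose U := W `&` av @^-1` P.
have oU : open U by apply: openI => //; apply: open_comp => // y _; exact: cav.
have Ux : U x.
  have Vx' : V x' := Vx.
  split; first exact/(VW x').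
  by exists x' => //; rewrite -(Va x').
have UP p : P p -> (U `&` stratum S k) (set_val (inv p)).
  move=> Pp; have [Vp cp] := invP p Pp.
  split; last exact: set_mem (svalP (inv p)).
  split; first exact/VW.
  by rewrite /preimage /= /av Va// cp.
have avU (u : U) : P (av (set_val u)) by have [] := set_mem (svalP u).
pose r (u : subds U) : subds (U `&` stratum S k) :=
  exist _ (set_val (inv (av (set_val u)))) (mem_set (UP _ (avU u))).
have cr : continuous r.
  move=> u; apply: continuous_subtype.
  apply: (@continuous_comp _ _ _ (fun u : U => inv (av (set_val u))) set_val).
    2: exact: initial_continuous.
  apply: (@continuous_comp _ _ _ (fun u : U => av (set_val u)) inv).
    2: exact: cinv.
  apply: (@continuous_comp _ _ _ set_val av); last exact: cav.
  exact: initial_continuous.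
have mr : ds_morphism r.
  (* Near [r u], [phi] is the restriction of some [h], whose chart expression [t] is smooth on the
     chart image. A cutoff [g] of [t] is smooth everywhere, so [g \o av] is a structure function,
     equal to [phi \o r] near [u]. *)
  split=> // phi Cphi u.
  have [B [oB Bu [h Ch phih]]] := Cphi (r u).
  have [t st ht] := Cinfty_restr sA Ch Ac.
  have Pu := avU u.
  have [g sg gt] := smooth_cutoff (chart_image_open atA Ac oc (fun _ => id))
    (@image_subset _ _ c.2 _ _ Vc _ Pu) st.
  have nB : nbhs u (r @^-1` B) by apply: cr; exact: open_nbhs_nbhs.
  have ng : nbhs u [set v : U | g (av (set_val v)) = t (av (set_val v))].
    apply: (@continuous_comp _ _ _ (@set_val _ U) av u _ _ _ gt).
      2: exact: cav.
    exact: initial_continuous.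
  have : nbhs u (r @^-1` B `&`
      [set v : U | g (av (set_val v)) = t (av (set_val v))]).
    exact: filterI.
  rewrite nbhsE => -[D [oD Du] DD].
  exists D; split=> //; exists (fun y => g (av y)); first exact: ds_smooth_row.
  move=> v /DD[/= Bv ->]; rewrite phih//=.
  have [Vv cv] := invP _ (avU v).
  by rewrite -[h _]/((h \o set_val) (inv (av (set_val v)))) ht ?cv//; exact: Vc.
have rid (u : U) : stratum S k (set_val u) -> set_val (r u) = set_val u.
  move=> ku; pose z : stratum S k := exist _ (set_val u) (mem_set ku).
  have Vz : V z by apply/VW; have [] := set_mem (svalP u).
  rewrite -[RHS]/(set_val z) -[LHS]/(set_val (inv (av (set_val z)))).
  by rewrite /av Va// invK.
exists (LocalRetraction oU Ux mr rid), a.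
split=> //= u v [Wu _] [Wv _] ku kv uv.
pose zu : stratum S k := exist _ u (mem_set ku).
pose zv : stratum S k := exist _ v (mem_set kv).
have Vu : V zu by apply/VW.
have Vv : V zv by apply/VW.
suff : zu = zv by move/(congr1 set_val).
by rewrite -(invK zu)// -(invK zv)// -!Va//= uv.
Qed.

End Retraction.

(** * Admissible maps are the morphisms of differential spaces *)

Section Admissible.
Context {R : realType}.

Lemma skeleton_stratum (S : diffspace R) n x :
  skeleton S n x -> exists k, stratum S k x.
Proof.
elim: n => [|n IH] sx; first by exists 0%N.
by have [/IH//|nx] := pselect (skeleton S n x); exists n.+1.
Qed.

(** The retraction is continuous and fixes [x]. *)
Lemma retraction_near (S : diffspace R) k x (r : local_retraction k x)
    (Q : set S) : stratum S k x -> nbhs x Q ->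
  \forall y \near x, forall u : lr_dom r, set_val u = y ->
    Q (set_val (lr_map r u)).
Proof.
move=> kx nQ; pose x' : lr_dom r := exist _ x (mem_set (lr_mem r)).
have rx : set_val (lr_map r x') = x by rewrite lr_id.
apply/(@nbhs_subtypeP _ _ x' (fun u => Q (set_val (lr_map r u)))).
apply: ((lr_morphism r).1 x' (set_val @^-1` Q)).
by apply: initial_continuous; rewrite rx.
Qed.

(* By injectivity on germs: [psi \o r] is locally the restriction of an element
   of the structure algebra that agrees with [psi] on the stratum. *)
Lemma retraction_germ (S : diffspace R) k x (A : set (@chart R (stratum S k) k))
    (r : local_retraction k x) (psi : S -> R) : is_stratum_structure A ->
  stratum S k x -> ds_fun psi ->
  \forall y \near x, forall u : lr_dom r, set_val u = y ->
    psi (set_val (lr_map r u)) = psi y.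
Proof.
move=> sA kx Cpsi; pose x' : lr_dom r := exist _ x (mem_set (lr_mem r)).
have Cr : sub_fun (fun v : (lr_dom r `&` stratum S k) => psi (set_val v)).
  by move=> v; exists setT; split=> //; [exact: openT|exists psi].
have [V [oV Vx [h Ch hr]]] := (lr_morphism r).2 _ Cr x'.
have nV : \forall y \near x, forall u : lr_dom r, set_val u = y -> V u.
  by apply/(@nbhs_subtypeP _ _ x' V); exact: open_nbhs_nbhs.
have nU : \forall y \near x, lr_dom r y.
  by apply: open_nbhs_nbhs; split; [exact: lr_open|exact: lr_mem].
have : \forall y \near x, h y = psi y.
  apply: (stratum_germ_inj sA) => //; apply: filterS2 nV nU => y Vy Uy ky.
  pose u : lr_dom r := exist _ y (mem_set Uy).
  by rewrite -(hr u (Vy u erefl)); congr psi; exact: (@lr_id _ _ _ _ r u ky).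
by apply: filterS2 nV => y Vy hy u uy; rewrite -hy -uy -hr//; exact: Vy.
Qed.

Lemma stratum_structureP (S : Stfd R) k :
  is_stratum_structure (@stratum_atlas R S k).
Proof. exact: (svalP (cid (st_stratum (svalP S) k))). Qed.

Lemma stratum_exists (S : Stfd R) (x : sval S) : exists k, stratum (sval S) k x.
Proof.
have [n Sn] := st_finite_dim (svalP S).
by apply: (@skeleton_stratum _ n); rewrite Sn.
Qed.

Lemma admissible_morphism (S S' : Stfd R) (f : sval S -> sval S') :
  admissible f -> ds_morphism f.
Proof.
move=> [cf rf sf]; split=> // phi Cphi; apply/ds_local => x.
have [i [j [ix [jx [r [r' rr']]]]]] := rf x.
pose x' : stratum (sval S) i := exist _ x (mem_set ix).
have [g Cg gf] := Cinfty_extend (stratum_structureP S i) x' (sf phi Cphi i).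
(* For points near [x]: [n1] gives [phi \o r' \o f = phi \o f], [n2] the same at retracted points,
   [n3] gives [phi \o f = g] at retracted points, as these lie on the stratum, and [n4] gives
   [g \o r = g]. *)
have n1 := cf x _ (retraction_germ r' (stratum_structureP S' j) jx Cphi).
have n2 := retraction_near r ix n1.
have n3 := retraction_near r ix ((@nbhs_subtypeP _ _ x' _).1 gf).
have n4 := retraction_germ r (stratum_structureP S i) ix Cg.
have : \forall y \near x, phi (f y) = g y.
  near=> y.
  have [u [v [w [uy vy wy vw]]]] : exists (u : lr_dom r) (v w : lr_dom r'),
       [/\ set_val u = y, set_val v = f (set_val (lr_map r u)),
           set_val w = f y & lr_map r' v = lr_map r' w] by near: y.
  have <- : phi (set_val (lr_map r' w)) = phi (f y).
    by move: w wy {vw}; near: y.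
  have <- : g (set_val (lr_map r u)) = g y by move: u uy {vy vw}; near: y.
  rewrite -vw.
  have -> : phi (set_val (lr_map r' v)) = phi (f (set_val (lr_map r u))).
    by move: v vy {vw}; move: u uy; near: y.
  have [_ ku] := set_mem (svalP (lr_map r u)).
  have gz : forall z : stratum (sval S) i, set_val z = set_val (lr_map r u) ->
      g (set_val z) = phi (f (set_val z)).
    by move: u uy {vy vw ku}; near: y.
  pose z : stratum (sval S) i := exist _ (set_val (lr_map r u)) (mem_set ku).
  by rewrite -(gz z erefl).
rewrite -nbhs_nearE nbhsE => -[U [oU Ux] Ug].
by exists U; split=> //; exists g.
Unshelve. all: by end_near.
Qed.

Lemma morphism_admissible (S S' : Stfd R) (f : sval S -> sval S') :
  ds_morphism f -> admissible f.
Proof.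
move=> [cf Cf]; split=> // [x|phi Cphi i]; last first.
  exact: (Cinfty_restr (stratum_structureP S i) (Cf phi Cphi)).
have [i ix] := stratum_exists x; have [j jx] := stratum_exists (f x).
exists i, j; split=> //; split=> //.
have [r _] :=
  local_retraction_exists (st_bump (svalP S)) (stratum_structureP S i) ix.
have [r' [a [Ca a_inj]]] :=
  local_retraction_exists (st_bump (svalP S')) (stratum_structureP S' j) jx.
exists r, r'.
have nU' : \forall z \near f x, lr_dom r' z.
  by apply: open_nbhs_nbhs; split; [exact: lr_open|exact: lr_mem].
have na : \forall z \near f x, forall j (w : lr_dom r'), set_val w = z ->
    a j (set_val (lr_map r' w)) = a j z.
  apply: filter_forall => l.
  exact: (retraction_germ r' (stratum_structureP S' j) jx (Ca l)).
have nf : \forall y \near x, forall j (u : lr_dom r), set_val u = y ->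
    a j (f (set_val (lr_map r u))) = a j (f y).
  apply: filter_forall => l.
  exact: (retraction_germ r (stratum_structureP S i) ix (Cf _ (Ca l))).
have nU : \forall y \near x, lr_dom r y.
  by apply: open_nbhs_nbhs; split; [exact: lr_open|exact: lr_mem].
(* [Q] holds near [f x]; pulling it back along [f], and then along [r], makes it available at both
   [f y] and [f (r y)]. *)
pose Q z := lr_dom r' z /\ forall j (w : lr_dom r'), set_val w = z ->
  a j (set_val (lr_map r' w)) = a j z.
have nQ : nbhs (f x) Q by exact: filterS2 nU' na.
have nQf := cf x _ nQ.
have nQr := retraction_near r ix nQf.
near=> y.
have Uy : lr_dom r y by near: y.
pose u : lr_dom r := exist _ y (mem_set Uy).
have [Uw aw] : Q (f y) by near: y.
have Qr : forall u : lr_dom r, set_val u = y -> Q (f (set_val (lr_map r u))).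
  by near: y.
have [Uv av] := Qr u erefl.
have nfy : forall j (u : lr_dom r), set_val u = y ->
    a j (f (set_val (lr_map r u))) = a j (f y) by near: y.
pose v : lr_dom r' := exist _ (f (set_val (lr_map r u))) (mem_set Uv).
pose w : lr_dom r' := exist _ (f y) (mem_set Uw).
exists u, v, w; split=> //; apply: val_inj.
have [Uv' kv] := set_mem (svalP (lr_map r' v)).
have [Uw' kw] := set_mem (svalP (lr_map r' w)).
(* Both sides lie on the stratum inside the domain of [r'], so comparing the coordinates [a]
   suffices. *)
apply: a_inj => //; apply/rowP => l; rewrite !mxE.
by rewrite (av l v erefl) (nfy l u erefl) (aw l w erefl).
Unshelve. all: by end_near.
Qed.

Lemma admissibleE (S S' : Stfd R) (f : sval S -> sval S') :
  admissible f <-> ds_morphism f.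
Proof. by split; [exact: admissible_morphism|exact: morphism_admissible]. Qed.

End Admissible.

(** * The equivalence of categories *)

Section Equivalence.
Context {R : realType}.
Local Notation K := (k_functor R).

Lemma admissible_homE (X Y : full_image K) (f : chom X Y) :
  admissible_hom f <-> @ds_morphism R (sval (im_src X)) (sval (im_src Y))
    (sval (@hom_transport (DiffeologyCat R) _ _ _ _ (im_eq X) (im_eq Y) f)).
Proof. exact: admissibleE. Qed.

(** Composites are treated as composites of morphisms rather than by composing local retractions. *)
Lemma admissible_hom_wide : is_wide (@admissible_hom R).
Proof.
split=> [[d s e]|[d1 s1 e1] [d2 s2 e2] [d3 s3 e3] f g].
  by apply/admissible_homE; case: d / e; exact: ds_morphism_id.
move=> /admissible_homE + /admissible_homE; rewrite admissible_homE.
(* Once the object equalities are reflexivity, all transports are identities. *)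
move: f g; case: d1 / e1; case: d2 / e2; case: d3 / e3 => f g mf mg.
exact: ds_morphism_comp mf mg.
Qed.

Lemma k_map_admissible (S S' : Stfd R) (f : chom S S') :
  @admissible_hom R (full_image_of K S) (full_image_of K S') (fmor K f).
Proof. exact/admissible_homE/(svalP f). Qed.

Let W := wide_subcat admissible_hom_wide.
Let kW : functor (Stfd R) W := corestrict admissible_hom_wide k_map_admissible.

Definition k_preimage (X Y : W) (f : chom X Y) :
    @chom (Stfd R) (im_src X) (im_src Y) :=
  exist _ _ ((admissible_homE _).1 (svalP f)).

Lemma k_preimage_id X : k_preimage (cidm X) = cidm (im_src X).
Proof. by apply: sig_val_inj => /=; case: X => d s e /=; case: d / e. Qed.

Lemma k_preimage_comp (X Y Z : W) (f : chom Y Z) (g : chom X Y) :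
  k_preimage (ccomp f g) = ccomp (k_preimage f) (k_preimage g).
Proof.
apply: sig_val_inj => /=; case: f g => [f _] [g _] /=; move: f g.
case: X Y Z => [d1 s1 e1] [d2 s2 e2] [d3 s3 e3] /=.
by case: d1 / e1; case: d2 / e2; case: d3 / e3.
Qed.

(** The quasi-inverse reads off the stratifold stored in each object. *)
Definition k_inverse : functor W (Stfd R) :=
  @Functor W (Stfd R) (fun X => im_src X) k_preimage
    k_preimage_id k_preimage_comp.

Lemma kW_bijective (S S' : Stfd R) :
  bijective (fmor kW : chom S S' -> chom (kW S) (kW S')).
Proof.
exists (@k_preimage (kW S) (kW S')) => f; first exact: sig_val_inj.
by do 2 apply: sig_val_inj.
Qed.

(** The identity map, transported along the stored equality by a dependent match; its source and
    target may differ as objects of [W]. *)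
Definition k_counit (X : W) : chom (kW (im_src X)) X :=
  match X return chom (kW (im_src X)) X with
  | FullImageObj d s e =>
    match e as e' in _ = d' return @chom W (kW s) (FullImageObj e') with
    | erefl => cidm (kW s)
    end
  end.

(** The unit consists of identities, since [k_inverse] after [kW] fixes objects and underlying maps;
    the counit reduces to identities by eliminating the stored equalities. *)
Lemma kW_equivalence : is_equivalence kW.
Proof.
exists k_inverse; split.
  exists (fun S => cidm S); split=> [S T f|S].
    by apply: sig_val_inj.
  by exists (cidm S); exact: cidl.
exists k_counit; split=> [[d1 s1 e1] [d2 s2 e2] f|[d s e]].
  case: d1 / e1 f; case: d2 / e2 => f /=.
  by do 2 apply: sig_val_inj.
by case: d / e; exists (cidm (kW s)); exact: cidl.
Qed.

End Equivalence.

Theorem theorem5p5 (R : realType) :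
  exists (w : is_wide (@admissible_hom R))
    (kP : forall (S S' : Stfd R) (f : chom S S'),
       @admissible_hom R (full_image_of (k_functor R) S) (full_image_of (k_functor R) S')
         (fmor (k_functor R) f)),
  let kW : functor (Stfd R) (wide_subcat w) := corestrict w kP in
  is_equivalence kW /\
  (forall S S' : Stfd R,
     bijective (fmor kW : chom S S' -> chom (kW S) (kW S'))) /\
  (forall (S T S' T' : Stfd R) (g : chom T S) (h : chom S' T') (f : chom S S'),
     fmor kW (ccomp h (ccomp f g)) =
     ccomp (fmor kW h) (ccomp (fmor kW f) (fmor kW g))).
Proof.
exists admissible_hom_wide, k_map_admissible.
split; first exact: kW_equivalence.
split; first exact: kW_bijective.
by move=> S T S' T' g h f; rewrite !fmor_comp.
Qed.
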